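(* For any prime $p>3$, we have $$\sum_{k=0}^{p-1}(3k-1)\frac{\left(-\frac{1}{2}\right)_k^2\left(\frac{1}{2}\right)_k4^k}{k!^3}\equiv p-2p^3\pmod{p^4}.$$
   Context: $(x)_k=x(x+1)\cdots(x+k-1)$ denotes the Pochhammer symbol, with $(x)_0=1$; $(x)_k^2$ means $((x)_k)^2$. A congruence modulo $p^4$ between rational numbers is understood in the ring of $p$-adic integers (equivalently, in the ring of rationals with denominator prime to $p$). *)

(* Defs.v *)
From mathcomp Require Import all_boot all_order all_algebra.

Set Implicit Arguments.
Unset Strict Implicit.
Unset Printing Implicit Defensive.

Import Order.TTheory GRing.Theory Num.Theory.
Local Open Scope ring_scope.

(* Rising factorial x (x + 1) ... (x + k - 1). *)
Definition pochhammer (R : pzSemiRingType) (x : R) (k : nat) : R :=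
  \prod_(0 <= i < k) (x + i%:R).

(* The subring Z_(p) of rationals whose reduced denominator is prime to p. *)
Definition p_integral (p : nat) (x : rat) : bool := coprime p `|denq x|%N.

(* Congruence modulo the ideal m Z_(p) of Z_(p); both sides must lie in Z_(p). *)
Definition p_congr (p m : nat) (a b : rat) : Prop :=
  [/\ p_integral p a, p_integral p b &
      exists2 c : rat, p_integral p c & a - b = m%:R * c].

(* Main.v *)
Require Import Defs.
From HB Require Import structures.
From mathcomp Require Import all_boot all_order all_algebra.
From mathcomp Require Import ring lra zify.

Set Implicit Arguments.
Unset Strict Implicit.
Unset Printing Implicit Defensive.

Import Order.TTheory GRing.Theory Num.Theory.
Local Open Scope ring_scope.

(** With [T_k = (1/2)_k^3 4^k / k!^3], the summand is [(3k - 1)/(2k - 1)^2 T_k];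
   it differs from [(3k + 1) T_k] by the forward difference of
   [-4 k^3/(2k - 1)^2 T_k], and [T_p = 1/2] modulo [p], which produces the
   [-2p^3].  It remains to see that [sum_(k < p) (3k + 1) T_k = p] modulo [p^4].

   The rational functions [(3k + 1) ((1+x)/2)_k ((1-x)/2)_k (1/2)_k 4^k /
   ((1+x)_k (1-x)_k k!)] deform [(3k + 1) T_k] and, divided by [x], satisfy a
   WZ relation for the shift [x -> x + 2].  Its residues at [x = 2j] form the
   pair [wzF], [wzG] below; since [wzF k j = 0] for [k < 2j], summing over [j]
   turns the sum over [k], for [p = 2m + 1], into [- sum_(j <= m) wzG p j].
   The term [j = m] is [p prod_(0 < i < p) (1 - p^2/(4 i^2))].  The others lie in
   [p^3 Z_(p)], and their consecutive ratios are [((2j + 1)/(2j + 3))^2] modulo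
   [p], so that they add up to a multiple of [p^3 sum_(j < m) 1/(2j + 1)^2]
   modulo [p^4].  Both [sum_(j < m) 1/(2j + 1)^2] and [sum_(0 < i < p) 1/i^2]
   vanish modulo [p]. *)

(** * The ring of p-integral rationals and the ideals generated by powers of p *)

Definition plocal (p : nat) : {pred rat} := p_integral p.

(** By Gauss the reduced denominator divides every [n] that clears [x], so an unreduced denominator
    prime to [p] is enough. Closure under ring operations then only multiplies denominators. *)
Lemma plocalP (p : nat) (x : rat) :
  reflect (exists2 n : nat, coprime p n & n%:R * x \is a Num.int)
          (x \in plocal p).
Proof.
apply: (iffP idP) => [px | [n pn /intrP[z nxz]]].
  exists `|denq x|%N => //; apply/intrP; exists (numq x).
  by rewrite numqE mulrC natr_absz ger0_norm.
apply: coprime_dvdr pn.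
suff: (denq x %| n%:Z)%Z by [].
have cd : coprimez (denq x) (numq x) by rewrite coprimezE coprime_sym coprime_num_den.
rewrite -(Gauss_dvdzl n%:Z cd); apply/dvdzP; exists z.
by apply: (intr_inj (R := rat)); rewrite !rmorphM /= numqE -nxz mulrA.
Qed.

Lemma plocal_subring_closed (p : nat) : subring_closed (plocal p).
Proof.
split=> [|x y|x y].
- by apply/plocalP; exists 1%N; rewrite ?coprimen1 ?mulr1 ?rpred1.
- move=> /plocalP[m pm mx] /plocalP[n pn ny]; apply/plocalP; exists (m * n)%N.
    by rewrite coprimeMr pm.
  have -> : (m * n)%:R * (x - y) = n%:R * (m%:R * x) - m%:R * (n%:R * y) by ring.
  by rewrite rpredB // rpredM // rpred_nat.
- move=> /plocalP[m pm mx] /plocalP[n pn ny]; apply/plocalP; exists (m * n)%N.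
    by rewrite coprimeMr pm.
  have -> : (m * n)%:R * (x * y) = (m%:R * x) * (n%:R * y) by ring.
  by rewrite rpredM.
Qed.

HB.instance Definition _ (p : nat) :=
  GRing.isSubringClosed.Build rat (plocal p) (@plocal_subring_closed p).

Lemma plocal_invn (p n : nat) : coprime p n -> n%:R^-1 \in plocal p.
Proof.
case: n => [|n] pn; first by rewrite invr0 rpred0.
by apply/plocalP; exists n.+1; rewrite ?mulfV ?rpred1 // pnatr_eq0.
Qed.

(* The ideal [p ^ n Z_(p)]. *)
Definition pdiv_by (p n : nat) : {pred rat} := [pred x | x / p%:R ^+ n \in plocal p].

Lemma pdiv_by_zmod_closed (p n : nat) : zmod_closed (pdiv_by p n).
Proof.
by split=> [|x y]; rewrite !inE ?mul0r ?rpred0 // mulrBl; apply: rpredB.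
Qed.

HB.instance Definition _ (p n : nat) :=
  GRing.isZmodClosed.Build rat (pdiv_by p n) (@pdiv_by_zmod_closed p n).

Lemma pdiv_byM (p m n : nat) (x y : rat) :
  x \in pdiv_by p m -> y \in pdiv_by p n -> x * y \in pdiv_by p (m + n).
Proof.
by rewrite !inE exprD invfM mulrACA; apply: rpredM.
Qed.

Lemma pdiv_by0 (p : nat) : pdiv_by p 0 =i plocal p.
Proof. by move=> x; rewrite inE expr0 divr1. Qed.

Lemma pdiv_byMl (p n : nat) (x y : rat) :
  x \in plocal p -> y \in pdiv_by p n -> x * y \in pdiv_by p n.
Proof. by rewrite -pdiv_by0; apply: pdiv_byM. Qed.

Lemma pdiv_by_expr (p n : nat) : (0 < p)%N -> p%:R ^+ n \in pdiv_by p n.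
Proof.
by move=> p0; rewrite inE divff ?rpred1 // expf_neq0 // pnatr_eq0 -lt0n.
Qed.

Lemma pdiv_by_exprM (p n : nat) (x : rat) :
  (0 < p)%N -> x \in plocal p -> p%:R ^+ n * x \in pdiv_by p n.
Proof.
by move=> p0 px; rewrite mulrC; apply: pdiv_byMl => //; apply: pdiv_by_expr.
Qed.

Lemma pdiv_by_leq (p m n : nat) (x : rat) : (0 < p)%N ->
  (m <= n)%N -> x \in pdiv_by p n -> x \in pdiv_by p m.
Proof.
move=> p0 mn px; rewrite inE.
have -> : x / p%:R ^+ m = p%:R ^+ (n - m) * (x / p%:R ^+ n).
  have pR : p%:R != 0 :> rat by rewrite pnatr_eq0 -lt0n.
  by rewrite -{2}(subnK mn) exprD invfM mulrCA mulVKf // expf_neq0.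
by apply: rpredM => //; apply/rpredX/rpred_nat.
Qed.

(** Every term of the expanded product beyond the linear ones contains two of the [x i]. *)
Lemma pdiv_by_prod1D (p n : nat) (r : seq nat) (x : nat -> rat) : (0 < p)%N ->
  (forall i, i \in r -> x i \in pdiv_by p n) ->
  \prod_(i <- r) (1 + x i) - (1 + \sum_(i <- r) x i) \in pdiv_by p (n + n).
Proof.
move=> p0; elim: r => [|i r IH] px; first by rewrite !big_nil addr0 subrr rpred0.
have pxi : x i \in pdiv_by p n by rewrite px ?mem_head.
have pxr j : j \in r -> x j \in pdiv_by p n by move=> jr; rewrite px ?inE ?jr ?orbT.
rewrite !big_cons.
set P := \prod_(j <- r) _; set s := \sum_(j <- r) _.
have -> : (1 + x i) * P - (1 + (x i + s))
  = (1 + x i) * (P - (1 + s)) + x i * s by ring.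
apply: rpredD.
  apply: pdiv_byMl (IH pxr); apply: rpredD; rewrite ?rpred1 //.
  by rewrite -pdiv_by0; apply: pdiv_by_leq pxi.
by apply: pdiv_byM => //; rewrite /s big_seq; apply: rpred_sum.
Qed.

(** * Rising factorials and their shifts at half-integers *)

Lemma pochhammer0 (R : pzSemiRingType) (x : R) : pochhammer x 0 = 1.
Proof. by rewrite /pochhammer big_geq. Qed.

Lemma pochhammerS (R : pzSemiRingType) (x : R) (k : nat) :
  pochhammer x k.+1 = pochhammer x k * (x + k%:R).
Proof. by rewrite /pochhammer big_nat_recr. Qed.

(** Both sides are [pochhammer x k.+1], with the first or the last factor split off. *)
Lemma pochhammer_shift (R : comPzSemiRingType) (x : R) (k : nat) :
  x * pochhammer (x + 1) k = pochhammer x k * (x + k%:R).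
Proof.
rewrite -pochhammerS /pochhammer big_nat_recl // addr0; congr (_ * _).
by apply: eq_bigr => i _; rewrite -addrA -natr1 [1 + _]addrC.
Qed.

Lemma half_integer_neq0 (m n : nat) : m%:R - n%:R + 1 / 2 != 0 :> rat.
Proof.
apply/eqP => h.
have /eqP : (2 * m + 1)%:R = (2 * n)%:R :> rat by rewrite natrD !natrM; lra.
by rewrite eqr_nat; lia.
Qed.

Lemma half_sub_neq0 (k j : nat) : k%:R - 1 / 2 - j%:R != 0 :> rat.
Proof.
by apply: contra_neq (half_integer_neq0 k j.+1); rewrite -(natr1 j); lra.
Qed.

Lemma pochhammer_halfDS (k j : nat) :
  pochhammer (1 / 2 + j.+1%:R) k
  = pochhammer (1 / 2 + j%:R) k * (1 / 2 + j%:R + k%:R) / (1 / 2 + j%:R) :> rat.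
Proof.
have h : 1 / 2 + j%:R != 0 :> rat.
  by have := half_integer_neq0 j 0; rewrite subr0 addrC.
rewrite -pochhammer_shift mulrAC mulfV // [RHS]mul1r.
by congr (pochhammer _ _); rewrite -(natr1 j) addrA.
Qed.

Lemma pochhammer_halfBS (k j : nat) :
  pochhammer (1 / 2 - j.+1%:R) k
  = pochhammer (1 / 2 - j%:R) k * - (1 / 2 + j%:R) / (k%:R - 1 / 2 - j%:R) :> rat.
Proof.
have e : 1 / 2 - j%:R = 1 / 2 - j.+1%:R + 1 :> rat by rewrite -(natr1 j); ring.
have := pochhammer_shift (1 / 2 - j.+1%:R : rat) k; rewrite -e.
have -> : 1 / 2 - j.+1%:R = - (1 / 2 + j%:R) :> rat by rewrite -(natr1 j); lra.
have -> : - (1 / 2 + j%:R) + k%:R = k%:R - 1 / 2 - j%:R :> rat by ring.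
by rewrite [_ * - _]mulrC => ->; rewrite mulfK ?half_sub_neq0.
Qed.

(** * The WZ pair and its telescoping *)

(* [invfact a b] is [1 / (a - b)!], read as [0] when [a < b]. *)
Definition invfact (a b : nat) : rat :=
  if (b <= a)%N then ((a - b)`!%:R)^-1 else 0.

Lemma invfactSS (a b : nat) : invfact a.+1 b.+1 = invfact a b.
Proof. by rewrite /invfact ltnS subSS. Qed.

(** At [a = b] the factor vanishes, in agreement with the default value 0. The recurrence thus holds
    for all [a] and [b], and the WZ relation needs no case distinction. *)
Lemma invfactSr (a b : nat) :
  invfact a b.+1 = (a%:R - b%:R) * invfact a b.
Proof.
rewrite /invfact; have [ba|ab|->] := ltngtP b a.
- rewrite -natrB 1?ltnW // -(subnSK ba) factS natrM invfM mulVKf //.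
  by rewrite pnatr_eq0.
- by rewrite mulr0.
- by rewrite subrr mul0r.
Qed.

Lemma natfact_neq0 (n : nat) : n`!%:R != 0 :> rat.
Proof. by rewrite pnatr_eq0 -lt0n fact_gt0. Qed.

(** The residue at x = 2j of 1/(x (1+x)_k (1-x)_k) is 1/((k+2j)! (k-2j)!); for k < 2j there is no
    pole and [invfact] gives 0. *)
Definition wzF (k j : nat) : rat :=
  (3 * k%:R + 1) * pochhammer (1 / 2 + j%:R) k * pochhammer (1 / 2 - j%:R) k *
  pochhammer (1 / 2) k * 4 ^+ k / (k`!%:R * (k + 2 * j)`!%:R) *
  invfact k (2 * j).

(** For k > 0, the divisor [k%:R - 1 / 2 - j%:R] cancels the last factor of
    [pochhammer (1 / 2 - j%:R) k]. *)
Definition wzG (k j : nat) : rat :=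
  - 2 * k%:R ^+ 2 * pochhammer (1 / 2 + j%:R) k * pochhammer (1 / 2 - j%:R) k *
  pochhammer (1 / 2) k * 4 ^+ k /
  (k`!%:R * (k%:R - 1 / 2 - j%:R) * (k + 2 * j).+1`!%:R) *
  invfact k (2 * j).+1.

Lemma wz_pair (k j : nat) :
  wzF k j.+1 - wzF k j = wzG k.+1 j - wzG k j.
Proof.
have h1 := half_sub_neq0 k j.
have h2 : k%:R + 1 - 1 / 2 - j%:R != 0 :> rat.
  by have := half_sub_neq0 k.+1 j; rewrite -(natr1 k).
have e2 : (2 * j.+1 = (2 * j).+2)%N by lia.
(* All shifts in [k] and [j] are reduced to the same rising factorials, factorials and
   [invfact k (2 * j)]; what remains is an identity of rational functions in [k] and [j]. *)
rewrite /wzF /wzG pochhammer_halfDS pochhammer_halfBS e2 invfactSS !invfactSr.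
rewrite !addnS addSn !factS !pochhammerS.
have eK : k.+1%:R = k%:R + 1 :> rat by rewrite natr1.
have eJ : (2 * j).+1%:R = 2 * j%:R + 1 :> rat by rewrite -natr1 natrM.
have e1 : (k + 2 * j).+1%:R = k%:R + 2 * j%:R + 1 :> rat by rewrite -natr1 natrD natrM.
have e3 : (k + 2 * j).+2%:R = k%:R + 2 * j%:R + 2 :> rat.
  by rewrite -addn2 natrD natrD natrM.
have h4 : k%:R + 1 != 0 :> rat by rewrite -eK pnatr_eq0.
have h5 : k%:R + 2 * j%:R + 1 != 0 :> rat by rewrite -e1 pnatr_eq0.
have h6 : k%:R + 2 * j%:R + 2 != 0 :> rat by rewrite -e3 pnatr_eq0.
rewrite [4 ^+ k.+1]exprS !natrM eK eJ e1 e3.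
move: (pochhammer _ k) (pochhammer _ k) (pochhammer _ k) => A B C.
have h0 : 1 / 2 + j%:R != 0 :> rat.
  by have := half_integer_neq0 j 0; rewrite subr0 addrC.
move: (natfact_neq0 k) (natfact_neq0 (k + 2 * j)) h0 h1 h2 h4 h5 h6.
move: (k`!%:R : rat) ((k + 2 * j)`!%:R : rat) (k%:R : rat) (j%:R : rat).
move=> f g K J f0 g0 h0 h1 h2 h4 h5 h6.
have h0' : 1 + J * 2 != 0 by apply: contra_neq h0; lra.
have h1' : K * 2 - 1 + - J * 2 != 0 by apply: contra_neq h1; lra.
have h2' : (K + 1) * 2 - 1 + - J * 2 != 0 by apply: contra_neq h2; lra.
by field; rewrite f0 g0 h0' h1' h2' h4 h5 h6.
Qed.

Lemma wzF_eq0 (k j : nat) : (k < 2 * j)%N -> wzF k j = 0.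
Proof. by move=> kj; rewrite /wzF /invfact leqNgt kj mulr0. Qed.

Lemma wzG0 (j : nat) : wzG 0 j = 0.
Proof. by rewrite /wzG /invfact mulr0. Qed.

Lemma sum_wzF0 (n m : nat) : (n <= 2 * m)%N ->
  \sum_(0 <= k < n) wzF k 0 = - \sum_(0 <= j < m) wzG n j.
Proof.
move=> nm.
have step j : \sum_(0 <= k < n) wzF k j.+1 - \sum_(0 <= k < n) wzF k j = wzG n j.
  rewrite -sumrB (eq_bigr _ (fun k _ => wz_pair k j)).
  by rewrite telescope_sumr // wzG0 subr0.
rewrite -(eq_bigr _ (fun j _ => step j)) telescope_sumr // opprB.
(* The far end [j = m] of the telescoping vanishes, because k < n <= 2m. *)
rewrite [X in _ - X]big_nat [X in _ - X]big1 ?subr0 // => k /andP[_ kn].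
by rewrite wzF_eq0 // (leq_trans kn).
Qed.

(** With a = 2j + 1, formally setting n = 0 in the ratio leaves a^2/(a+2)^2. The denominators are
    kept as natural numbers so that their invertibility becomes a coprimality condition. *)
Lemma wzG_recr (n j : nat) : (2 * j + 3 < n)%N ->
  wzG n j.+1 =
  - ((2 * n%:R + (2 * j%:R + 1)) * (n%:R - (2 * j%:R + 1)) *
     (n%:R - (2 * j%:R + 1) - 1)) /
    ((2 * n - (2 * j + 3))%:R * (n + (2 * j + 2))%:R * (n + (2 * j + 3))%:R) *
  wzG n j.
Proof.
move=> jn.
have e2 : (2 * j.+1 = (2 * j).+2)%N by lia.
have eJ : j.+1%:R = j%:R + 1 :> rat by rewrite natr1.
have e1 : (2 * j).+1%:R = 2 * j%:R + 1 :> rat by rewrite -natr1 natrM.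
have e3 : (2 * j).+2%:R = 2 * j%:R + 2 :> rat by rewrite -addn2 natrD natrM.
have e4 : (2 * n - (2 * j + 3))%:R = 2 * n%:R - 2 * j%:R - 3 :> rat.
  by rewrite natrB; [rewrite [(2 * j + 3)%:R]natrD !natrM; ring | lia].
have e5 : (n + (2 * j + 2))%:R = n%:R + 2 * j%:R + 2 :> rat.
  by rewrite natrD [(2 * j + _)%:R]natrD natrM; ring.
have e6 : (n + (2 * j + 3))%:R = n%:R + 2 * j%:R + 3 :> rat.
  by rewrite natrD [(2 * j + _)%:R]natrD natrM; ring.
have e7 : (n + 2 * j).+2 = (n + (2 * j + 2))%N by lia.
have e8 : (n + 2 * j).+3 = (n + (2 * j + 3))%N by lia.
have h0 : 1 / 2 + j%:R != 0 :> rat.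
  by have := half_integer_neq0 j 0; rewrite subr0 addrC.
have h1 := half_sub_neq0 n j.
have h2 : n%:R - 1 / 2 - (j%:R + 1) != 0 :> rat by rewrite -eJ half_sub_neq0.
have h3 : n%:R + 2 * j%:R + 2 != 0 :> rat by rewrite -e5 pnatr_eq0; lia.
have h4 : n%:R + 2 * j%:R + 3 != 0 :> rat by rewrite -e6 pnatr_eq0; lia.
rewrite /wzG pochhammer_halfDS pochhammer_halfBS e2 e4 e5 e6 !addnS.
rewrite (invfactSr n (2 * j).+2) (invfactSr n (2 * j).+1).
rewrite (factS (n + 2 * j).+2) (factS (n + 2 * j).+1) e8 e7 2!natrM eJ e1 e3 e5 e6.
move: (pochhammer _ n) (pochhammer _ n) (pochhammer _ n) => A B C.
move: (natfact_neq0 n) (natfact_neq0 (n + 2 * j).+1) h0 h1 h2 h3 h4.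
move: (n`!%:R : rat) ((n + 2 * j).+1`!%:R : rat) (n%:R : rat) (j%:R : rat).
move=> f g K J f0 g0 h0 h1 h2 h3 h4.
have h0' : 1 + J * 2 != 0 by apply: contra_neq h0; lra.
have h1' : K * 2 - 1 + - J * 2 != 0 by apply: contra_neq h1; lra.
have h2' : 2 * K - 2 * J - 3 != 0 by apply: contra_neq h2; lra.
by field; rewrite f0 g0 h0' h1' h2' h3 h4.
Qed.

(** * Sums of inverse squares modulo p *)

Lemma prime_coprime_lt (p n : nat) :
  prime p -> (0 < n < p)%N -> coprime p n.
Proof.
move=> pp /andP[n0 np]; rewrite prime_coprime //.
by apply/negP => /(dvdn_leq n0); rewrite leqNgt np.
Qed.

Lemma prime_coprime_add (p n : nat) :
  prime p -> (0 < n < p)%N -> coprime p (p + n).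
Proof. by move=> pp np; rewrite /coprime gcdnDl -/(coprime p n) prime_coprime_lt. Qed.

(** Modulo [p], [p - i] is [- i], and squaring removes the sign. *)
Lemma inv_sq_sub (p i : nat) : prime p -> (0 < i < p)%N ->
  (p - i)%:R ^- 2 - i%:R ^- 2 \in pdiv_by p 1.
Proof.
move=> pp /andP[i0 ip]; have p0 := prime_gt0 pp.
have j0 : (0 < p - i)%N by rewrite subn_gt0.
have -> : (p - i)%:R ^- 2 - i%:R ^- 2 =
   p%:R ^+ 1 * ((2 * i%:R - p%:R) * (p - i)%:R^-1 ^+ 2 * i%:R^-1 ^+ 2) :> rat.
  have h1 : i%:R != 0 :> rat by rewrite pnatr_eq0 -lt0n.
  have h2 : (p - i)%:R != 0 :> rat by rewrite pnatr_eq0 -lt0n.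
  have -> : p%:R = (p - i)%:R + i%:R :> rat by rewrite -natrD subnK // ltnW.
  by field; rewrite h1 h2.
apply: pdiv_by_exprM => //; apply: rpredM; first apply: rpredM.
- by rewrite rpredB ?rpredM ?rpred_nat.
- by apply/rpredX/plocal_invn/prime_coprime_lt => //; lia.
- by apply/rpredX/plocal_invn/prime_coprime_lt => //; lia.
Qed.

Lemma sum_odd_even (f : nat -> rat) (m : nat) :
  \sum_(0 <= i < 2 * m) f i =
  \sum_(0 <= j < m) f (2 * j)%N + \sum_(0 <= j < m) f (2 * j).+1.
Proof.
elim: m => [|m IH]; first by rewrite muln0 !big_geq // addr0.
have -> : (2 * m.+1 = (2 * m).+2)%N by lia.
by rewrite !big_nat_recr //= IH; ring.
Qed.

(** Let h be the sum over 1 <= i <= m. The reflection i -> p - i exchanges odd and even indices, so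
    the odd part is h/4 modulo p; it also exchanges the two halves, so the upper half is h. The full
    sum is thus both h/2 and 2h modulo p, which forces h to vanish since 3 is invertible. *)
Lemma sum_inv_sq (m : nat) : prime (2 * m).+1 -> (3 < (2 * m).+1)%N ->
  \sum_(0 <= j < m) (2 * j).+1%:R ^- 2 \in pdiv_by (2 * m).+1 1 /\
  \sum_(0 <= j < 2 * m) j.+1%:R ^- 2 \in pdiv_by (2 * m).+1 1.
Proof.
set p := (2 * m).+1 => pp p3; have p0 := prime_gt0 pp.
set h : rat := \sum_(0 <= j < m) j.+1%:R ^- 2.
have E : \sum_(0 <= j < m) (2 * j).+2%:R ^- 2 = h / 4.
  rewrite /h big_distrl; apply: eq_bigr => j _ /=.
  have -> : (2 * j).+2%:R = 2 * j.+1%:R :> rat.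
    by rewrite -natrM; congr _%:R; lia.
  have : j.+1%:R != 0 :> rat by rewrite pnatr_eq0.
  by move: (j.+1%:R : rat) => x x0; field; rewrite x0.
set O : rat := \sum_(0 <= j < m) (2 * j).+1%:R ^- 2.
have HO : O - h / 4 \in pdiv_by p 1.
  rewrite -E /O big_nat_rev /= -sumrB big_nat; apply: rpred_sum => j /andP[_ jm].
  have -> : (2 * (0 + m - j.+1)).+1 = (p - (2 * j).+2)%N by rewrite /p; lia.
  by apply: inv_sq_sub => //; rewrite /p; lia.
have Hh : \sum_(0 <= j < m) (m + j).+1%:R ^- 2 - h \in pdiv_by p 1.
  rewrite big_nat_rev /= -sumrB big_nat; apply: rpred_sum => j /andP[_ jm].
  have -> : (m + (0 + m - j.+1)).+1 = (p - j.+1)%N by rewrite /p; lia.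
  by apply: inv_sq_sub => //; rewrite /p; lia.
have HE := sum_odd_even (fun i => i.+1%:R ^- 2) m.
have {HE} HE : \sum_(0 <= j < 2 * m) j.+1%:R ^- 2 = O + h / 4 by rewrite HE E.
have Hhalf : \sum_(0 <= j < 2 * m) j.+1%:R ^- 2 =
    h + \sum_(0 <= j < m) (m + j).+1%:R ^- 2 :> rat.
  rewrite {1}mul2n -addnn (big_cat_nat (n := m)) //= ?leq_addr // -/h.
  rewrite -[X in \sum_(X <= _ < _) _]add0n big_addn addnK; congr (_ + _).
  by apply: eq_bigr => j _; rewrite addnC.
have inv_loc n : (0 < n < p)%N -> n%:R^-1 \in plocal p.
  by move=> np; apply/plocal_invn/prime_coprime_lt.
have h_div : h \in pdiv_by p 1.
  have -> : h = 3^-1 * (2 * ((O - h / 4)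
      - (\sum_(0 <= j < m) (m + j).+1%:R ^- 2 - h))).
    by move: Hhalf; rewrite HE; set s := \sum_(_ <= _ < _) _; lra.
  apply: pdiv_byMl; first exact: inv_loc.
  by rewrite pdiv_byMl ?rpred_nat // rpredB.
have h4_div : h / 4 \in pdiv_by p 1.
  have -> : h / 4 = 2^-1 * (2^-1 * h) by lra.
  have i2 : 2^-1 \in plocal p by apply: inv_loc; rewrite (ltn_trans _ p3).
  by do 2 apply: pdiv_byMl => //.
have O_div : O \in pdiv_by p 1 by rewrite -(subrK (h / 4) O) rpredD.
by rewrite HE; split=> //; apply: rpredD.
Qed.

(** * The value (1/2)_p and the central binomial coefficient *)

Ltac plocal_closed := repeat first
  [assumption | apply: rpred_nat | apply: rpred1 | apply: rpredX => /=
  | apply: rpredM => /= | rewrite rpredN | apply: rpredD => /=].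

(** One factor 2^n turns (1/2)_n into the product of the odd numbers below 2n, the other turns n!
    into that of the even numbers up to 2n. *)
Lemma pochhammer_half_fact (n : nat) :
  pochhammer (1 / 2) n * 4 ^+ n * n`!%:R = (2 * n)`!%:R :> rat.
Proof.
elim: n => [|n IH]; first by rewrite pochhammer0 muln0 expr0 !mulr1.
have -> : (2 * n.+1 = (2 * n).+2)%N by lia.
rewrite !factS !natrM -IH pochhammerS exprS -(natr1 n) -(natr1 (2 * n).+1).
by rewrite -(natr1 (2 * n)) natrM; field.
Qed.

Lemma fact_add_prod (p n : nat) :
  (p + n)`!%:R = p`!%:R * n`!%:R * \prod_(1 <= i < n.+1) (1 + p%:R / i%:R) :> rat.
Proof.
elim: n => [|n IH]; first by rewrite addn0 big_geq // !mulr1.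
have h : n.+1%:R != 0 :> rat by rewrite pnatr_eq0.
rewrite addnS !factS !natrM IH [in RHS]big_nat_recr // -addnS natrD /=.
set P := \prod_(1 <= i < n.+1) _.
by move: (n.+1%:R : rat) h => x x0; field; rewrite x0.
Qed.

(* The central binomial coefficient 'C(2p, p). *)
Definition cbin (p : nat) : rat := 2 * \prod_(1 <= i < p) (1 + p%:R / i%:R).

Lemma pochhammer_half (p : nat) : (0 < p)%N ->
  pochhammer (1 / 2) p = cbin p * p`!%:R / 4 ^+ p :> rat.
Proof.
case: p => // p _; set P := \prod_(1 <= i < p.+1) (1 + p.+1%:R / i%:R) : rat.
have h4 : 4 ^+ p.+1 != 0 :> rat by rewrite expf_neq0.
apply: (mulIf h4); apply: (mulIf (natfact_neq0 p.+1)).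
rewrite divfK // pochhammer_half_fact.
(* Splitting the top factor off the factorial stops the product one short of [p.+1]; that factor
   supplies the 2 in [cbin]. *)
have -> : (2 * p.+1 = (p.+1 + p).+1)%N by lia.
rewrite factS natrM (fact_add_prod p.+1 p) /cbin -/P [p.+1`!]factS !natrM.
have -> : (p.+1 + p).+1%:R = 2 * p.+1%:R :> rat by rewrite -natrM; congr _%:R; lia.
by ring.
Qed.

(** Each factor 1 + p/i is 1 modulo p, as i < p is invertible. *)
Lemma cbin_congr (p : nat) : prime p -> cbin p - 2 \in pdiv_by p 1.
Proof.
move=> pp; have p0 := prime_gt0 pp.
rewrite /cbin -[X in _ - X]mulr1 -mulrBr.
apply: pdiv_byMl; first exact: rpred_nat.
set x := fun i : nat => p%:R / i%:R : rat.
have px i : i \in index_iota 1 p -> x i \in pdiv_by p 1.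
  rewrite mem_index_iota => ip; rewrite /x -[p%:R]expr1.
  by apply: pdiv_by_exprM => //; apply/plocal_invn/prime_coprime_lt.
have -> : \prod_(1 <= i < p) (1 + p%:R / i%:R) - 1 =
    (\prod_(1 <= i < p) (1 + x i) - (1 + \sum_(1 <= i < p) x i))
      + \sum_(1 <= i < p) x i by ring.
apply: rpredD; last by rewrite big_seq; apply: rpred_sum.
by apply: pdiv_by_leq (pdiv_by_prod1D _ px).
Qed.

Lemma cbin_plocal (p : nat) : prime p -> cbin p \in plocal p.
Proof.
move=> pp; rewrite -(subrK 2 (cbin p)) rpredD ?rpred_nat //.
by rewrite -pdiv_by0; apply: pdiv_by_leq (prime_gt0 pp) _ (cbin_congr pp).
Qed.

Lemma coprime_pow4 (p n : nat) : prime p -> (3 < p)%N -> coprime p (4 ^ n).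
Proof.
move=> pp p3; apply: coprimeXr; apply: (@coprimeXr 2 p 2).
by apply: prime_coprime_lt => //; rewrite (ltn_trans _ p3).
Qed.

Lemma plocal_invX4 (p n : nat) : prime p -> (3 < p)%N ->
  (4 ^+ n)^-1 \in plocal p.
Proof.
by move=> pp p3; rewrite -natrX; apply/plocal_invn/coprime_pow4.
Qed.

(** * The boundary terms [wzG p j] modulo p^4 *)

(** Since (1/2)_p / p! is p-integral, the factorials cancel up to p!/(p-1)! = p, which joins the
    explicit p^2. *)
Lemma wzG_0_div (p : nat) : prime p -> (3 < p)%N -> wzG p 0 \in pdiv_by p 3.
Proof.
move=> pp p3; have p0 := prime_gt0 pp.
have -> : wzG p 0 = p%:R ^+ 3 *
   (- 4 * cbin p ^+ 3 * (4 ^+ p)^-1 ^+ 2 * (2 * p - 1)%:R^-1 * (p + 1)%:R^-1).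
  have e : p%:R - 1 / 2 - 0 != 0 :> rat by have := half_sub_neq0 p 0.
  have f : p`!%:R = p%:R * (p - 1)`!%:R :> rat.
    by rewrite -natrM -{1}(subnK p0) addn1 factS subn1 prednK.
  have eS : p.+1%:R = p%:R + 1 :> rat by rewrite natr1.
  have eB : (2 * p - 1)%:R = 2 * p%:R - 1 :> rat.
    by rewrite natrB ?natrM //; lia.
  rewrite /wzG muln0 addn0 mulr0n subr0 addr0 (pochhammer_half p0) /invfact p0.
  rewrite factS natrM f eS natrD eB.
  have hP : p%:R != 0 :> rat by rewrite pnatr_eq0 -lt0n.
  have hS : p%:R + 1 != 0 :> rat by rewrite -eS pnatr_eq0.
  have h4 : 4 ^+ p != 0 :> rat by rewrite expf_neq0.
  move: e hP hS h4 (natfact_neq0 (p - 1)).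
  move: (cbin p) ((p - 1)`!%:R : rat) (p%:R : rat) (4 ^+ p : rat).
  move=> c g P E e hP hS h4 hg.
  have e' : 2 * P - 1 != 0 by apply: contra_neq e; lra.
  by field; rewrite e' hP hS h4 hg.
have d1 : (2 * p - 1)%:R^-1 \in plocal p.
  have -> : (2 * p - 1 = p + (p - 1))%N by lia.
  by apply/plocal_invn/prime_coprime_add => //; lia.
have d2 : (p + 1)%:R^-1 \in plocal p.
  by apply/plocal_invn/prime_coprime_add => //; lia.
apply: pdiv_by_exprM => //.
move: (cbin_plocal pp) (plocal_invX4 p pp p3) d1 d2.
move: (cbin p) (4 ^+ p)^-1 _%:R^-1 _%:R^-1 => c e x y hc he hx hy.
by plocal_closed.
Qed.

(** Induction on [j]: the ratio of consecutive terms is p-integral, which preserves divisibility by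
    p^3, and it is a^2/(a+2)^2 modulo p, which preserves a^2 [wzG p j] modulo p^4. *)
Lemma wzG_congr (p j : nat) : prime p -> (3 < p)%N -> (2 * j + 1 < p)%N ->
  wzG p j \in pdiv_by p 3 /\
  (2 * j%:R + 1) ^+ 2 * wzG p j - wzG p 0 \in pdiv_by p 4.
Proof.
move=> pp p3; have p0 := prime_gt0 pp.
elim: j => [|j IH] jp.
  by rewrite mulr0n mulr0 add0r expr1n mul1r subrr rpred0 wzG_0_div.
have [|{IH} IH1 IH2] := IH; first lia.
set a : rat := 2 * j%:R + 1 in IH2.
set d : rat := (2 * p - (2 * j + 3))%:R^-1 * (p + (2 * j + 2))%:R^-1
  * (p + (2 * j + 3))%:R^-1.
have d_loc : d \in plocal p.
  rewrite /d !rpredM //; apply/plocal_invn.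
  - have -> : (2 * p - (2 * j + 3) = p + (p - (2 * j + 3)))%N by lia.
    by apply: prime_coprime_add => //; lia.
  - by apply: prime_coprime_add => //; lia.
  - by apply: prime_coprime_add => //; lia.
have a_loc : a \in plocal p.
  by have -> : a = (2 * j + 1)%:R; rewrite ?rpred_nat // natrD natrM.
set num := (2 * p%:R + a) * (p%:R - a) * (p%:R - a - 1).
have num_loc : num \in plocal p.
  by rewrite /num; plocal_closed.
have rec : wzG p j.+1 = - num * d * wzG p j.
  by rewrite wzG_recr; [rewrite /num /d !invfM | lia].
have IH1' : wzG p j.+1 \in pdiv_by p 3.
  by rewrite rec; apply: pdiv_byMl => //; plocal_closed.
split=> //.
(* As polynomials in p, (a+2)^2 times [- num] and a^2 times the denominator have the same constant
   term; the cofactor of [d] is their difference divided by p. *)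
have -> : (2 * j.+1%:R + 1) ^+ 2 * wzG p j.+1 - wzG p 0 =
    p%:R ^+ 1 * (d * ((a + 2) ^+ 2 * (- 2 * p%:R ^+ 2 + (3 * a + 2) * p%:R - a)
      - a ^+ 2 * (2 * p%:R ^+ 2 + (3 * a + 4) * p%:R - a - 2))) * wzG p j
    + (a ^+ 2 * wzG p j - wzG p 0).
  have -> : 2 * j.+1%:R + 1 = a + 2 :> rat by rewrite /a -(natr1 j); ring.
  have a2 : a ^+ 2 = a ^+ 2 * d * ((2 * p%:R - a - 2) * (p%:R + a + 1) * (p%:R + a + 2)).
    have h n : (0 < n)%N -> n%:R != 0 :> rat by rewrite pnatr_eq0 -lt0n.
    have -> : 2 * p%:R - a - 2 = (2 * p - (2 * j + 3))%:R :> rat.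
      rewrite natrB; last lia.
      by rewrite [(2 * j + 3)%:R]natrD !natrM /a; ring.
    have -> : p%:R + a + 1 = (p + (2 * j + 2))%:R :> rat.
      by rewrite natrD [(2 * j + _)%:R]natrD natrM /a; ring.
    have -> : p%:R + a + 2 = (p + (2 * j + 3))%:R :> rat.
      by rewrite natrD [(2 * j + _)%:R]natrD natrM /a; ring.
    rewrite /d -!invfM mulfVK // !mulf_neq0 // h //; lia.
  rewrite rec [X in _ = _ + (X * _ - _)]a2 /num.
  move: (wzG _ _) (wzG _ _) (p%:R : rat) => x y P.
  by ring.
apply: rpredD => //; apply: (@pdiv_byM p 1 3) => //; apply: pdiv_by_exprM => //.
by plocal_closed.
Qed.

(** At [j = m] the two shifted bases are p/2 and 1 - p/2, and their factors pair up as i^2 -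
    p^2/4. *)
Lemma wzG_last (m : nat) :
  wzG (2 * m).+1 m = - ((2 * m).+1%:R * \prod_(1 <= i < (2 * m).+1)
    (1 + - ((2 * m).+1%:R ^+ 2 / 4 * i%:R ^- 2))).
Proof.
set p := (2 * m).+1; set X : rat := p%:R / 2.
have p_neq0 : p%:R != 0 :> rat by rewrite pnatr_eq0.
have pE : p%:R = 2 * m%:R + 1 :> rat by rewrite /p -natr1 natrM.
have A : pochhammer X p = X * \prod_(1 <= i < p) (X + i%:R).
  by rewrite /pochhammer big_ltn // addr0.
(* The last factor is p - X = X, which becomes the leading factor here. *)
have B : pochhammer (- X + 1) p = X * \prod_(1 <= i < p) (- X + i%:R).
  have hX : - X != 0 by rewrite oppr_eq0 mulf_neq0.
  apply: (mulfI hX); rewrite pochhammer_shift /pochhammer big_ltn // addr0.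
  by have -> : p%:R = X + X :> rat; [rewrite /X; lra | ring].
have AB : (\prod_(1 <= i < p) (X + i%:R)) * (\prod_(1 <= i < p) (- X + i%:R)) =
    (2 * m)`!%:R ^+ 2 * \prod_(1 <= i < p) (1 + - (p%:R ^+ 2 / 4 * i%:R ^- 2)).
  rewrite fact_prod natr_prod expr2 -!big_split /= !big_nat.
  apply: eq_bigr => i /andP[i0 _].
  have : i%:R != 0 :> rat by rewrite pnatr_eq0 -lt0n.
  by rewrite /X; move: (i%:R : rat) => x x0; field; rewrite x0.
rewrite /wzG.
have -> : 1 / 2 + m%:R = X by rewrite /X pE; lra.
have -> : 1 / 2 - m%:R = - X + 1 by rewrite /X pE; lra.
have -> : p%:R - 1 / 2 - m%:R = X by rewrite /X pE; lra.
(* The factorial is now (2p)!, which cancels against (1/2)_p 4^p p!. *)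
have -> : ((p + 2 * m).+1 = 2 * p)%N by rewrite /p; lia.
rewrite -pochhammer_half_fact /invfact leqnn subnn fact0 A B.
have fE : p`!%:R = p%:R * (2 * m)`!%:R :> rat by rewrite /p factS natrM.
have H0 : pochhammer (1 / 2) p != 0 :> rat.
  apply: contraTneq (natfact_neq0 (2 * p)) => H0.
  by rewrite -pochhammer_half_fact H0 !mul0r eqxx.
have E0 : 4 ^+ p != 0 :> rat by rewrite expf_neq0.
move: AB H0 E0 (natfact_neq0 (2 * m)); rewrite fE /X => {A B}.
move: (\prod_(_ <= _ < _) _) (\prod_(_ <= _ < _) _) (\prod_(_ <= _ < _) _).
move: (pochhammer _ _) (4 ^+ p) ((2 * m)`!%:R : rat) (p%:R : rat) p_neq0.
move=> h e f P P0 a b c ab h0 e0 f0.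
have -> : a = c * b / f ^+ 2 by rewrite ab mulrAC mulfV ?mul1r // expf_neq0.
by field; rewrite P0 f0 h0 e0.
Qed.

Lemma sum_wzF0_congr (p : nat) : prime p -> (3 < p)%N ->
  \sum_(0 <= k < p) wzF k 0 - p%:R \in pdiv_by p 4.
Proof.
move=> pp p3; have p0 := prime_gt0 pp.
have [m pm] : exists m, p = (2 * m).+1.
  exists p./2; rewrite mul2n -[LHS]odd_double_half.
  by case: (even_prime pp) p3 => [->|->].
have ltp j : (j < m)%N -> (2 * j + 1 < p)%N by rewrite pm; lia.
(* As p = 2m + 1 exceeds 2m, the range must include [j = m], the one term not divisible by p^3. *)
rewrite (@sum_wzF0 p m.+1); last by rewrite pm; lia.
rewrite big_nat_recr //= opprD.
have [SO SH] : \sum_(0 <= j < m) (2 * j).+1%:R ^- 2 \in pdiv_by p 1 /\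
  \sum_(0 <= j < 2 * m) j.+1%:R ^- 2 \in pdiv_by p 1.
  by move: pp p3; rewrite pm; apply: sum_inv_sq.
have sum_div : \sum_(0 <= j < m) wzG p j \in pdiv_by p 4.
  (* Each term is replaced by [wzG p 0] divided by (2j+1)^2, with an error in p^4 Z_(p); the main
     part gains its fourth p from the sum of inverse squares. *)
  have -> : \sum_(0 <= j < m) wzG p j = \sum_(0 <= j < m)
       ((2 * j).+1%:R^-1 ^+ 2 * ((2 * j%:R + 1) ^+ 2 * wzG p j - wzG p 0)) +
     wzG p 0 * \sum_(0 <= j < m) (2 * j).+1%:R ^- 2.
    rewrite big_distrr -big_split /=; apply: eq_bigr => j _.
    have -> : (2 * j).+1%:R = 2 * j%:R + 1 :> rat by rewrite -natr1 natrM.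
    have : 2 * j%:R + 1 != 0 :> rat by rewrite -natrM natr1 pnatr_eq0.
    by move: (2 * j%:R + 1) => x x0; field; rewrite x0.
  apply: rpredD; last by apply: (@pdiv_byM p 3 1) => //; apply: wzG_0_div.
  rewrite big_nat; apply: rpred_sum => j /andP[_ jm].
  have [_ ?] := wzG_congr pp p3 (ltp j jm); apply: pdiv_byMl => //.
  by apply/rpredX/plocal_invn/prime_coprime_lt => //; have := ltp j jm; lia.
have last_div : - wzG p m - p%:R \in pdiv_by p 4.
  have -> : wzG p m = wzG (2 * m).+1 m by rewrite pm.
  rewrite wzG_last -pm opprK.
  set x := fun i : nat => - (p%:R ^+ 2 / 4 * i%:R ^- 2) : rat.
  have i4 : 4^-1 \in plocal p by apply: (plocal_invX4 1).
  have px i : i \in index_iota 1 p -> x i \in pdiv_by p 2.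
    rewrite mem_index_iota => ip; rewrite /x rpredN -mulrA.
    apply: pdiv_by_exprM => //; apply: rpredM => //.
    by rewrite -exprVn; apply/rpredX/plocal_invn/prime_coprime_lt.
  have Sx : \sum_(1 <= i < p) x i =
      - (p%:R ^+ 2 * (4^-1 * \sum_(0 <= j < 2 * m) j.+1%:R ^- 2)).
    rewrite -[X in \sum_(X <= _ < _) _]add0n pm big_addn subn1 /= -pm.
    rewrite !big_distrr -sumrN /=; apply: eq_bigr => i _.
    by rewrite /x addn1 mulrA.
  (* The [x i] lie in p^2 Z_(p), so linearizing the product costs p^4; the linear part is p^3 times
     a sum divisible by p. *)
  have -> : p%:R * \prod_(1 <= i < p) (1 + x i) - p%:R =
     p%:R * (\prod_(1 <= i < p) (1 + x i) - (1 + \sum_(1 <= i < p) x i))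
     - p%:R ^+ 3 * 4^-1 * \sum_(0 <= j < 2 * m) j.+1%:R ^- 2.
    by rewrite Sx; ring.
  apply: rpredB.
    apply: pdiv_byMl; first exact: rpred_nat.
    exact: pdiv_by_prod1D px.
  by apply: (@pdiv_byM p 3 1) => //; apply: pdiv_by_exprM.
have -> : forall a b c : rat, - a - b - c = - a + (- b - c) by move=> *; ring.
by rewrite rpredD ?rpredN.
Qed.

(** * Return to the original sum and the final congruence *)

Lemma pochhammer_neg_half (k : nat) :
  pochhammer (- (1 / 2)) k = - (pochhammer (1 / 2) k / (2 * k%:R - 1)) :> rat.
Proof.
have h := half_sub_neq0 k 0.
have h' : - (1 / 2) + k%:R != 0 :> rat by apply: contra_neq h; rewrite mulr0n; lra.
apply: (mulIf h'); rewrite -pochhammer_shift.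
have -> : - (1 / 2) + 1 = 1 / 2 :> rat by lra.
have : 2 * k%:R - 1 != 0 :> rat by apply: contra_neq h; rewrite mulr0n; lra.
by move: (k%:R : rat) => x x0; field; rewrite x0.
Qed.

Lemma wzF_0 (k : nat) :
  wzF k 0 =
  (3 * k%:R + 1) * (pochhammer (1 / 2) k ^+ 3 * 4 ^+ k / k`!%:R ^+ 3).
Proof.
rewrite /wzF muln0 addn0 mulr0n !(subr0, addr0) /invfact leq0n subn0.
move: (pochhammer _ _) (k`!%:R : rat) (natfact_neq0 k) => h f f0.
by field; rewrite f0.
Qed.

(** Since T_(n+1)/T_n = (2n+1)^3/(2(n+1)^3), the new boundary term is 2(2n+1) T_n, and the induction
    step reduces to 3n - 1 = 4n^3 - (n+1)(2n-1)^2. *)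
Lemma sum_contiguous (n : nat) :
  \sum_(0 <= k < n) (3 * k%:R - 1) *
     (pochhammer (- (1 / 2)) k ^+ 2 * pochhammer (1 / 2) k * 4 ^+ k
        / (k`!)%:R ^+ 3) =
  \sum_(0 <= k < n) wzF k 0
  - 4 * n%:R ^+ 3 / (2 * n%:R - 1) ^+ 2
    * (pochhammer (1 / 2) n ^+ 3 * 4 ^+ n / n`!%:R ^+ 3) :> rat.
Proof.
elim: n => [|n IH]; first by rewrite !big_geq // mulr0n expr0n /= mulr0 !mul0r subr0.
rewrite !big_nat_recr //= IH pochhammer_neg_half wzF_0.
rewrite factS natrM pochhammerS [4 ^+ n.+1]exprS -(natr1 n).
have h := half_sub_neq0 n 0.
have h1 : 2 * n%:R - 1 != 0 :> rat by apply: contra_neq h; rewrite mulr0n; lra.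
have h2 : 2 * (n%:R + 1) - 1 != 0 :> rat.
  by have := half_integer_neq0 n 0; rewrite mulr0n; apply: contra_neq; lra.
have h3 : n%:R + 1 != 0 :> rat by rewrite natr1 pnatr_eq0.
move: (natfact_neq0 n) h1 h2 h3; move: (\sum_(_ <= _ < _) _) => s.
move: (pochhammer _ _) (4 ^+ n) (n`!%:R : rat) (n%:R : rat).
move=> a e f x f0 h1 h2 h3.
by field; rewrite f0 h1 h2 h3.
Qed.

Theorem theorem1p2 (p : nat) (p_prime : prime p) (p_gt3 : (3 < p)%N) :
  p_congr p (p ^ 4)
    (\sum_(0 <= k < p)
       (3 * k%:R - 1) *
       (pochhammer (- (1 / 2)) k ^+ 2 * pochhammer (1 / 2) k * 4 ^+ k
          / (k`!)%:R ^+ 3))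
    (p%:R - 2 * p%:R ^+ 3).
Proof.
have p0 := prime_gt0 p_prime.
have p_neq0 : p%:R != 0 :> rat by rewrite pnatr_eq0 -lt0n.
set S := \sum_(_ <= _ < _) _; set b := p%:R - _.
suff Sb : S - b \in pdiv_by p 4.
  have b_loc : b \in plocal p by rewrite /b; plocal_closed.
  split=> //; last first.
    by exists ((S - b) / p%:R ^+ 4) => //; rewrite natrX mulrC divfK ?expf_neq0.
  apply: (_ : S \in plocal p); rewrite -(subrK b S) rpredD //.
  by rewrite -pdiv_by0; apply: pdiv_by_leq Sb.
have q_loc : (2 * p - 1)%:R^-1 \in plocal p.
  have -> : (2 * p - 1 = p + (p - 1))%N by lia.
  by apply/plocal_invn/prime_coprime_add => //; lia.
set q : rat := (2 * p - 1)%:R^-1 in q_loc.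
have q_neq0 : (2 * p - 1)%:R != 0 :> rat by rewrite pnatr_eq0; lia.
have qE : 2 * p%:R - 1 = (2 * p - 1)%:R :> rat by rewrite natrB ?natrM //; lia.
set e : rat := (4 ^+ p)^-1.
have e_loc : e \in plocal p by apply: plocal_invX4.
have e_neq0 : 4 ^+ p != 0 :> rat by rewrite expf_neq0.
have c_loc := cbin_plocal p_prime.
(* Fermat gives 4^p = 4 modulo p. *)
have e_congr : (4 ^+ p) ^+ 2 - 16 \in pdiv_by p 1.
  have /eqP := fermat_little 4 p_prime.
  rewrite eqn_mod_dvd; last by rewrite -{1}(expn1 4) leq_exp2l.
  case/dvdnP=> n nE.
  have -> : (4 ^+ p) ^+ 2 - 16 = (4 ^+ p + 4) * (n%:R * p%:R ^+ 1) :> rat.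
    rewrite -natrM -nE natrB -?natrX; last by rewrite -{1}(expn1 4) leq_exp2l.
    by rewrite natrX; ring.
  by do 2?[apply: pdiv_byMl; first by plocal_closed]; apply: pdiv_by_expr.
have c_congr : cbin p ^+ 3 - 8 \in pdiv_by p 1.
  have -> : cbin p ^+ 3 - 8 = (cbin p ^+ 2 + 2 * cbin p + 4) * (cbin p - 2) by ring.
  by apply: pdiv_byMl (cbin_congr p_prime); plocal_closed.
(* The boundary term plus 2p^3 is 2p^3 [q ^+ 2 * e ^+ 2] times 16^p (2p-1)^2 - 2 [cbin p ^+ 3]. This
   last factor is split using (2p-1)^2 = 1 + p(4p-4) and 16 = 2 * 8, each piece being divisible by
   p. *)
have -> : S - b = (\sum_(0 <= k < p) wzF k 0 - p%:R)
   + p%:R ^+ 3 * (2 * q ^+ 2 * e ^+ 2) *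
     ((4 ^+ p) ^+ 2 * (p%:R ^+ 1 * (4 * p%:R - 4)) + ((4 ^+ p) ^+ 2 - 16)
       - 2 * (cbin p ^+ 3 - 8)).
  rewrite /S sum_contiguous /b (pochhammer_half p0) qE.
  have -> : 2 * q ^+ 2 * e ^+ 2 = 2 / (2 * p%:R - 1) ^+ 2 / (4 ^+ p) ^+ 2.
    by rewrite qE /q /e !exprVn.
  rewrite -qE in q_neq0 *.
  move: (natfact_neq0 p) e_neq0 q_neq0; move: (\sum_(_ <= _ < _) _) (cbin p).
  move: (4 ^+ p : rat) (p`!%:R : rat) (p%:R : rat).
  move=> x f P s c f0 x0 q0.
  by field; rewrite f0 x0 q0.
apply: rpredD; first exact: sum_wzF0_congr.
apply: (@pdiv_byM p 3 1).
  by apply: pdiv_by_exprM => //; plocal_closed.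
apply: rpredB; last by apply: pdiv_byMl => //; apply: rpred_nat.
apply: rpredD => //; apply: pdiv_byMl; first by plocal_closed.
by apply: pdiv_by_exprM => //; plocal_closed.
Qed.
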